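(* Let $P\geq 3$ be an odd integer, let $N\geq 1$ be an integer, and let $G$ be a finite trivalent graph. Then there is a natural bijection $$\operatorname{Ed}_{P,N,G}\cong \operatorname{Ed}_{P,1,G}\times \operatorname{Ed}_{2P,1,G}^{\,N-1},$$ where $\operatorname{Ed}_{P,N,G}$ denotes the set of $(P,N)$-edge-numberings of $G$.
   Context: Finite graphs: a finite graph $G$ consists of finite sets $V(G)$, $E(G)$, $H(G)$ of vertices, edges and half-edges, with maps $\nu:H(G)\to V(G)$ and $\epsilon:H(G)\to E(G)$ such that every fiber of $\epsilon$ has cardinality $2$. Multiple edges and loops are allowed. For a vertex $v$, $H_v=\nu^{-1}(v)$ is the set of branches incident to $v$. $G$ is trivalent if $|H_v|=3$ for every vertex $v$ (so a loop at $v$ contributes two of the three branches). The set ${}^\dagger C_N(P)$: for integers $P\geq 2$, $N\geq 1$, let ${}^\dagger C_N(P)$ be the set of triples $(a_1,a_2,a_3)\in\mathbb{Z}_{\geq 0}^3$ such that $$a_1+a_2+a_3\leq P^N-2,\qquad |a_2-a_3|\leq a_1\leq a_2+a_3,$$ and such that, for every $1\leq M\leq N$, writing $[a_i]_M$ for the remainder of $a_i$ modulo $P^M$, there are choices $a_{i,M}\in\{[a_i]_M,\;P^M-1-[a_i]_M\}$ ($i=1,2,3$) such that $$a_{1,M}+a_{2,M}+a_{3,M}\leq P^M-2,\qquad |a_{2,M}-a_{3,M}|\leq a_{1,M}\leq a_{2,M}+a_{3,M}.$$ This set is invariant under permutations of the coordinates. Edge-numberings: $\operatorname{Ed}_{P,N,G}$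 is the set of functions $\ell:E(G)\to\mathbb{Z}_{\geq 0}$ such that at every vertex $v$ of $G$ the labels $\ell(\epsilon(h))$ of the three incident branches $h\in H_v$ form a triple in ${}^\dagger C_N(P)$. *)

(* Defs.v *)
From HB Require Import structures.
From mathcomp Require Import all_boot ssrint.

Set Implicit Arguments.
Unset Strict Implicit.
Unset Printing Implicit Defensive.

Import IntDist.
Local Open Scope nat_scope.

(* Multiple edges and loops are allowed; the two half-edges of a loop have the
   same image under [nu]. *)
Record graph := Graph {
  vertex : finType;
  edge : finType;
  half_edge : finType;
  nu : half_edge -> vertex;
  eps : half_edge -> edge;
  card_eps_fiber : forall e : edge, #|[set h | eps h == e]| = 2
}.

Definition branches (G : graph) (v : vertex G) : {set half_edge G} :=
  [set h | nu h == v].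

Definition trivalent (G : graph) : Prop :=
  forall v : vertex G, #|branches v| = 3.

Record trivalent_graph := TrivalentGraph {
  tgraph :> graph;
  tgraphP : trivalent tgraph
}.

(* [`|a2 - a3|] is the absolute difference. The subtraction [Q - 2] is
   truncated, but [Q >= 2] wherever this is used. *)
Definition triangle_bounded (Q a1 a2 a3 : nat) : bool :=
  (a1 + a2 + a3 <= Q - 2) && (`|a2 - a3| <= a1 <= a2 + a3).

Definition residue_choice (Q : nat) (c : bool) (a : nat) : nat :=
  if c then Q - 1 - a %% Q else a %% Q.

Definition dagC (P N a1 a2 a3 : nat) : bool :=
  triangle_bounded (P ^ N) a1 a2 a3 &&
  [forall M : 'I_N.+1, (1 <= M) ==>
    [exists c1 : bool, exists c2 : bool, exists c3 : bool,
      triangle_bounded (P ^ M)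
        (residue_choice (P ^ M) c1 a1)
        (residue_choice (P ^ M) c2 a2)
        (residue_choice (P ^ M) c3 a3)]].

(* All orderings of the three branches at [v] are tested; [dagC P N] is
   invariant under permutations of the coordinates. *)
Definition edge_numbering (P N : nat) (G : trivalent_graph)
    (l : {ffun edge G -> nat}) : bool :=
  [forall v : vertex G,
    forall h1 in branches v, forall h2 in branches v, forall h3 in branches v,
      uniq [:: h1; h2; h3] ==> dagC P N (l (eps h1)) (l (eps h2)) (l (eps h3))].

Definition Ed (P N : nat) (G : trivalent_graph) : Type :=
  {l : {ffun edge G -> nat} | edge_numbering P N l}.

(* Maps of graphs that are bijective on the branches at each vertex; these
   include isomorphisms, coverings and inclusions of unions of connected
   components, and edge-numberings pull back along them. *)
Record local_iso (G G' : graph) := LocalIso {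
  on_vertex : vertex G -> vertex G';
  on_edge : edge G -> edge G';
  on_half : half_edge G -> half_edge G';
  on_half_nu : forall h, nu (on_half h) = on_vertex (nu h);
  on_half_eps : forall h, eps (on_half h) = on_edge (eps h);
  on_half_inj : forall v, {in branches v &, injective on_half};
  on_half_surj : forall v, on_half @: branches v = branches (on_vertex v)
}.

Definition pull_label (G G' : trivalent_graph) (f : local_iso G G')
    (l : {ffun edge G' -> nat}) : {ffun edge G -> nat} :=
  [ffun e => l (on_edge f e)].

Lemma pull_label_subproof (P N : nat) (G G' : trivalent_graph)
    (f : local_iso G G') (l : Ed P N G') :
  edge_numbering P N (pull_label f (val l)).
Proof.
case: l => l /= /forallP Hl.
apply/forallP => v; apply/forall_inP => h1 b1; apply/forall_inP => h2 b2.
apply/forall_inP => h3 b3; apply/implyP => u.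
have bf h : h \in branches v -> on_half f h \in branches (on_vertex f v).
  by move=> bh; rewrite -on_half_surj imset_f.
have /forall_inP /(_ _ (bf _ b1)) /forall_inP H1 := Hl (on_vertex f v).
have /forall_inP /(_ _ (bf _ b3)) /implyP := H1 _ (bf _ b2).
rewrite /pull_label !ffunE -!on_half_eps; apply.
rewrite -[X in uniq X]/(map (on_half f) [:: h1; h2; h3]) map_inj_in_uniq //.
have sub x : x \in [:: h1; h2; h3] -> x \in branches v.
  by rewrite !in_cons in_nil orbF => /or3P[] /eqP ->.
by move=> x y /sub bx /sub b_y; apply: (@on_half_inj _ _ f v).
Qed.

Definition Ed_pull (P N : nat) (G G' : trivalent_graph) (f : local_iso G G')
    (l : Ed P N G') : Ed P N G :=
  exist _ (pull_label f (val l)) (pull_label_subproof f l).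

(* The target Ed_{P,1,G} x Ed_{2P,1,G}^{N-1}, with pullback taken
   componentwise. *)
Definition Ed_split (P N : nat) (G : trivalent_graph) : Type :=
  (Ed P 1 G * {ffun 'I_N.-1 -> Ed (2 * P) 1 G})%type.

Definition Ed_split_pull (P N : nat) (G G' : trivalent_graph)
    (f : local_iso G G') (x : Ed_split P N G') : Ed_split P N G :=
  (Ed_pull f x.1, [ffun j => Ed_pull f (x.2 j)]).

(* Natural transformation between the contravariant functors
   Ed_{P,N,-} and Ed_{P,1,-} x Ed_{2P,1,-}^{N-1} on trivalent graphs. *)
Definition Ed_natural (P N : nat)
    (Phi : forall G : trivalent_graph, Ed P N G -> Ed_split P N G) : Prop :=
  forall (G G' : trivalent_graph) (f : local_iso G G') (l : Ed P N G'),
    Phi G (Ed_pull f l) = Ed_split_pull f (Phi G' l).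

(* Main.v *)
Require Import Defs.
From mathcomp Require Import all_boot zify.

Set Implicit Arguments.
Unset Strict Implicit.
Unset Printing Implicit Defensive.

(** Write [x_i = 2 * a_i + 1].  Then [triangle_bounded Q a1 a2 a3] says that
    [(x1, x2, x3)] lies in the open tetrahedron [T_Q] given by
    [x1 + x2 + x3 < 2 Q] and the three strict triangle inequalities; this is
    the regular tetrahedron inscribed in the cube [[0, Q]^3].  The choice
    between [a %% Q] and [Q - 1 - a %% Q] is the choice of a representative of
    [x] under the group generated by [x |-> - x] and [x |-> x + 2 Q].  Since
    every label of a triple in [T_Q] satisfies [x_i < Q], only the smaller
    representative [fold Q a] can be used, so the existential choices in
    [dagC] are forced ([residue_choiceE]).

    A label [a] is determined by [b = fold Q a] and by the index
    [d = digit Q a] of the interval [[d Q, (d + 1) Q]] that contains [x]; it is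
    recovered as [unfold Q b d].  The key point, [triangle_bounded_unfold], is
    that for a triple with folded labels in [T_Q] the condition at level [P Q]
    depends on the indices only.  Such a point [x] lies in a reflected copy of
    [T_Q] inscribed in the cube of index [(d1, d2, d3)].  The walls of [T_Q]
    and of [T_PQ] all belong to the family of planes
    [x1 +- x2 +- x3 = 2 Q k], [k] an integer, which is stable under the group
    above and misses [T_Q], hence its copies.  Since the copy is convex and
    contains the centre of the cube, [x] lies in [T_PQ] if and only if the
    centre does, and the centre has coordinates [(2 * d_i + 1) Q / 2]: after
    rescaling, this is the condition that [(d1, d2, d3)] satisfies
    [triangle_bounded (2 * P)].

    With [Q = P ^ N], and because folding modulo [P ^ N] does not disturb later
    foldings modulo smaller powers ([fold_fold]), one gets [dagCS]: a triple is
    in level [N + 1] if and only if its folds are in level [N] and its digits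
    are in level 1 for [2 * P].  Every edge has a half-edge, hence occurs in
    the condition at some vertex, so all labels of a numbering are in the range
    where [fold], [digit] and [unfold] are mutually inverse.  Applying them
    edge by edge identifies [Ed P N.+1 G] with [Ed P N G * Ed (2 * P) 1 G];
    being edgewise, this commutes with pullback.  Iterating from [N = 1] gives
    the result. *)

(** * Triangles, folding and digits *)

Lemma triangle_boundedE Q a1 a2 a3 : 2 <= Q ->
  triangle_bounded Q a1 a2 a3 =
  [&& a1 + a2 + a3 + 2 <= Q, a1 <= a2 + a3, a2 <= a1 + a3 & a3 <= a1 + a2].
Proof. by rewrite /triangle_bounded => Q2; lia. Qed.

(** Each label is at most half the perimeter, and the strict inequality excludes
    the label [(Q - 1) / 2], the one equal to its own complement. *)
Lemma triangle_bounded_half Q a1 a2 a3 :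
  2 <= Q -> triangle_bounded Q a1 a2 a3 ->
  [/\ 2 * a1 + 1 < Q, 2 * a2 + 1 < Q & 2 * a3 + 1 < Q].
Proof. by move=> Q2; rewrite triangle_boundedE // => T; split; lia. Qed.

(** For [0 < Q] and [x = 2 * a + 1], the number [2 * fold Q a + 1] is the
    distance from [x] to the nearest multiple of [2 * Q]. *)
Definition fold Q a := minn (a %% Q) (Q - 1 - a %% Q).

(** The index of the interval of length [Q] that contains [2 * a + 1].  When [Q]
    divides [2 * a + 1] there is ambiguity, but then [2 * fold Q a + 1 >= Q], so
    no admissible label is affected. *)
Definition digit Q a := (2 * a + 1) %/ Q.

(** The label [a] with [2 * a + 1] at distance [2 * b + 1] from the even end of
    the interval [[d * Q, d.+1 * Q]]: the even multiples of [Q] are the mirrors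
    of the folding. *)
Definition unfold Q b d :=
  if odd d then d.+1./2 * Q - 1 - b else d./2 * Q + b.

Lemma unfold_double Q b q : unfold Q b (2 * q) = q * Q + b.
Proof. by rewrite /unfold mul2n odd_double doubleK. Qed.

Lemma unfold_doubleS Q b q : 2 * b + 1 < Q ->
  unfold Q b (2 * q).+1 = q * Q + (Q - 1 - b).
Proof.
move=> hb; have -> : unfold Q b (2 * q).+1 = q.+1 * Q - 1 - b.
  by rewrite /unfold oddS mul2n odd_double -doubleS doubleK.
by rewrite mulSn; lia.
Qed.

Lemma double_or_doubleS d : exists q, d = 2 * q \/ d = (2 * q).+1.
Proof. by exists d./2; lia. Qed.

Lemma fold_unfold Q b d : 2 * b + 1 < Q -> fold Q (unfold Q b d) = b.
Proof.
move=> hb; rewrite /fold; have [q [|] ->] := double_or_doubleS d.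
  by rewrite unfold_double modnMDl modn_small; lia.
by rewrite unfold_doubleS // modnMDl modn_small; lia.
Qed.

Lemma digit_unfold Q b d : 2 * b + 1 < Q -> digit Q (unfold Q b d) = d.
Proof.
move=> hb; rewrite /digit; have [q [|] ->] := double_or_doubleS d.
  rewrite unfold_double mulnDr -addnA mulnA.
  by rewrite divnMDl ?divn_small; lia.
rewrite unfold_doubleS //.
have -> : 2 * (q * Q + (Q - 1 - b)) + 1 = (2 * q).+1 * Q + (Q - (2 * b + 1)).
  by rewrite mulSn mulnDr mulnA; lia.
by rewrite divnMDl ?divn_small; lia.
Qed.

Lemma unfoldK Q a : 2 * fold Q a + 1 < Q -> unfold Q (fold Q a) (digit Q a) = a.
Proof.
set b := fold Q a => hb.
(* Any preimage of the fold will do: [digit_unfold] identifies its index. *)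
suff [d ->] : exists d, a = unfold Q b d by rewrite digit_unfold.
have rQ : a %% Q < Q by rewrite ltn_pmod; lia.
have [hr|hr] := ltnP (2 * (a %% Q) + 1) Q.
  exists (2 * (a %/ Q)); rewrite unfold_double {1}(divn_eq a Q) /b /fold; lia.
exists (2 * (a %/ Q)).+1; rewrite unfold_doubleS // {1}(divn_eq a Q) /b /fold.
lia.
Qed.

(** Linear consequences of comparing [x + k] with [y], in a form that leaves
    [x * Q] and [y * Q] as atoms for linear arithmetic. *)
Lemma leq_shift_mul Q k x y :
  (x + k <= y -> x * Q + k * Q <= y * Q) /\
  (y <= x + k -> y * Q <= x * Q + k * Q).
Proof. by rewrite -mulnDl; split=> ?; rewrite leq_mul. Qed.

(** No plane [x1 = x2 + x3 + 2 Q k] meets the copy of the tetrahedron: with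
    [d_i = 2 * q_i] or [2 * q_i + 1], the difference of the two sides of the
    first inequality is, up to a constant, a multiple of [Q] plus a signed sum
    of the [b_i], which the hypothesis confines to an interval of length less
    than [Q]. *)
Lemma unfold_leqD Q b1 b2 b3 d1 d2 d3 :
  2 <= Q -> triangle_bounded Q b1 b2 b3 ->
  (unfold Q b1 d1 <= unfold Q b2 d2 + unfold Q b3 d3) = (d1 <= d2 + d3).
Proof.
move=> Q2 Tb; have [hb1 hb2 hb3] := triangle_bounded_half Q2 Tb.
move: Tb; rewrite triangle_boundedE // => Tb.
have [q1 e1] := double_or_doubleS d1; have [q2 e2] := double_or_doubleS d2.
have [q3 e3] := double_or_doubleS d3.
(* The number of odd digits on each side moves the threshold between the
   [q_i] by at most these shifts. *)
move: (leq_shift_mul Q 1 q1 (q2 + q3)) (leq_shift_mul Q 0 (q2 + q3) q1).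
move: (leq_shift_mul Q 1 (q2 + q3) q1) (leq_shift_mul Q 2 (q2 + q3) q1).
rewrite !mulnDl => ? ? ? ?.
by case: e1 => ->; case: e2 => ->; case: e3 => ->;
  rewrite ?unfold_double ?unfold_doubleS //; lia.
Qed.

(** The same separation for the planes [x1 + x2 + x3 = 2 Q k]. *)
Lemma unfold_perimeter P Q b1 b2 b3 d1 d2 d3 :
  2 <= Q -> triangle_bounded Q b1 b2 b3 ->
  (unfold Q b1 d1 + unfold Q b2 d2 + unfold Q b3 d3 + 2 <= P * Q) =
  (d1 + d2 + d3 + 2 <= 2 * P).
Proof.
move=> Q2 Tb; have [hb1 hb2 hb3] := triangle_bounded_half Q2 Tb.
move: Tb; rewrite triangle_boundedE // => Tb.
have [q1 e1] := double_or_doubleS d1; have [q2 e2] := double_or_doubleS d2.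
have [q3 e3] := double_or_doubleS d3.
move: (leq_shift_mul Q 0 (q1 + q2 + q3) P) (leq_shift_mul Q 1 (q1 + q2 + q3) P).
move: (leq_shift_mul Q 2 (q1 + q2 + q3) P) (leq_shift_mul Q 3 (q1 + q2 + q3) P).
rewrite !mulnDl => ? ? ? ?.
by case: e1 => ->; case: e2 => ->; case: e3 => ->;
  rewrite ?unfold_double ?unfold_doubleS //; lia.
Qed.

Lemma triangle_boundedCA Q a1 a2 a3 : 2 <= Q ->
  triangle_bounded Q a1 a2 a3 = triangle_bounded Q a2 a1 a3.
Proof. by move=> Q2; rewrite !triangle_boundedE //; lia. Qed.

Lemma triangle_boundedAC Q a1 a2 a3 : 2 <= Q ->
  triangle_bounded Q a1 a2 a3 = triangle_bounded Q a1 a3 a2.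
Proof. by move=> Q2; rewrite !triangle_boundedE //; lia. Qed.

(** The tetrahedron condition at level [P * Q] holds on a whole reflected copy
    of the small tetrahedron or nowhere on it, so it may be tested at the centre
    of the ambient cube. *)
Lemma triangle_bounded_unfold P Q b1 b2 b3 d1 d2 d3 : 2 <= P ->
  2 <= Q -> triangle_bounded Q b1 b2 b3 ->
  triangle_bounded (P * Q) (unfold Q b1 d1) (unfold Q b2 d2) (unfold Q b3 d3) =
  triangle_bounded (2 * P) d1 d2 d3.
Proof.
move=> P2 Q2 T123.
have T213 : triangle_bounded Q b2 b1 b3 by rewrite triangle_boundedCA.
have T312 : triangle_bounded Q b3 b1 b2.
  by rewrite triangle_boundedCA // triangle_boundedAC.
rewrite !triangle_boundedE ?(leq_trans P2) ?leq_pmulr ?leq_pmull //;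
  last exact: ltnW.
by rewrite unfold_perimeter // !unfold_leqD.
Qed.

Lemma fold_small Q a : 2 * a + 1 < Q -> fold Q a = a.
Proof. by move=> aQ; rewrite /fold modn_small; lia. Qed.

Lemma foldC Q a : a < Q -> fold Q (Q - 1 - a) = fold Q a.
Proof. by move=> aQ; rewrite /fold !modn_small; lia. Qed.

Lemma fold_periodic Q k a : fold Q (k * Q + a) = fold Q a.
Proof. by rewrite /fold modnMDl. Qed.

(** The reflections used to fold modulo [P * Q] are among those used to fold
    modulo [Q]. *)
Lemma fold_fold P Q a : 0 < P -> 0 < Q -> fold Q (fold (P * Q) a) = fold Q a.
Proof.
move=> P0 Q0; set r := a %% (P * Q).
have rPQ : r < P * Q by rewrite ltn_pmod // muln_gt0 P0.
have fold_r : fold Q r = fold Q a by rewrite /fold modn_dvdm ?dvdn_mull.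
rewrite {2}/fold -/r; case: leqP => _ //.
have -> : P * Q - 1 - r = (P - 1 - r %/ Q) * Q + (Q - 1 - r %% Q).
  have := divn_eq r Q; have := ltn_pmod r Q0.
  have : r %/ Q < P by rewrite ltn_divLR.
  nia.
rewrite fold_periodic foldC ?ltn_pmod //.
by rewrite -fold_r {2}(divn_eq r Q) fold_periodic.
Qed.

(** * The admissible triples at consecutive levels *)

(** A residue and its complement cannot both be below [(Q - 1) / 2], so only
    the smaller one can occur in a triple satisfying the triangle condition. *)
Lemma residue_choiceE Q a1 a2 a3 : 2 <= Q ->
  [exists c1 : bool, exists c2 : bool, exists c3 : bool,
      triangle_bounded Q (residue_choice Q c1 a1) (residue_choice Q c2 a2)
        (residue_choice Q c3 a3)] =
  triangle_bounded Q (fold Q a1) (fold Q a2) (fold Q a3).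
Proof.
move=> Q2.
have choice_fold c a :
    2 * residue_choice Q c a + 1 < Q -> residue_choice Q c a = fold Q a.
  rewrite /residue_choice /fold; case: c; have := ltn_pmod a (ltnW Q2); lia.
have fold_choice a : exists c, fold Q a = residue_choice Q c a.
  rewrite /fold /residue_choice; case: leqP => _.
    by exists false.
  by exists true.
apply/idP/idP.
  move=> /existsP[c1 /existsP[c2 /existsP[c3 T]]].
  have [h1 h2 h3] := triangle_bounded_half Q2 T.
  by rewrite -!(choice_fold _ _ h1, choice_fold _ _ h2, choice_fold _ _ h3).
have [c1 ->] := fold_choice a1; have [c2 ->] := fold_choice a2.
have [c3 ->] := fold_choice a3.
by move=> T; do 3![apply/existsP; eexists]; exact: T.
Qed.

Lemma expn_ge2 P M : 2 <= P -> 1 <= M -> 2 <= P ^ M.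
Proof.
move=> P2 M1; apply: (leq_trans P2).
by rewrite -[X in X <= _]expn1 leq_pexp2l ?(ltnW P2).
Qed.

Lemma dagCP P N a1 a2 a3 : 2 <= P ->
  reflect (triangle_bounded (P ^ N) a1 a2 a3 /\
    forall M, 1 <= M <= N ->
    triangle_bounded (P ^ M)
      (fold (P ^ M) a1) (fold (P ^ M) a2) (fold (P ^ M) a3))
  (dagC P N a1 a2 a3).
Proof.
move=> P2; apply: (iffP andP) => -[Ta TM]; split=> //.
  move=> M /andP[M1 MN]; have /forallP/(_ (Ordinal (MN : M < N.+1))) := TM.
  by rewrite M1 /= residue_choiceE ?expn_ge2.
apply/forallP => M; apply/implyP => M1.
by rewrite residue_choiceE ?expn_ge2 // TM // M1 -ltnS ltn_ord.
Qed.

Lemma triangle_bounded_fold Q a1 a2 a3 : 2 <= Q ->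
  triangle_bounded Q a1 a2 a3 ->
  triangle_bounded Q (fold Q a1) (fold Q a2) (fold Q a3).
Proof.
move=> Q2 T; have [h1 h2 h3] := triangle_bounded_half Q2 T.
by rewrite !fold_small.
Qed.

(** At level 1 the folding condition repeats the first one, since labels in the
    tetrahedron are their own folds. *)
Lemma dagC1 Q a1 a2 a3 : 2 <= Q ->
  dagC Q 1 a1 a2 a3 = triangle_bounded Q a1 a2 a3.
Proof.
move=> Q2; apply/dagCP/idP => //; first by case; rewrite expn1.
move=> T; split; rewrite ?expn1 // => M; rewrite -eqn_leq => /eqP <-.
by rewrite expn1 triangle_bounded_fold.
Qed.

Lemma dagC_half P N a1 a2 a3 : 2 <= P -> 1 <= N -> dagC P N a1 a2 a3 ->
  2 * a1 + 1 < P ^ N.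
Proof.
by move=> P2 N1 /dagCP[] // /triangle_bounded_half-/(_ (expn_ge2 P2 N1))[].
Qed.

(** For [M <= N] the folding conditions of the triple and of its folds coincide;
    the conditions at level [N.+1] become the condition on digits. *)
Lemma dagCS P N a1 a2 a3 : 2 <= P -> 1 <= N ->
  dagC P N.+1 a1 a2 a3 =
  dagC P N (fold (P ^ N) a1) (fold (P ^ N) a2) (fold (P ^ N) a3) &&
  dagC (2 * P) 1 (digit (P ^ N) a1) (digit (P ^ N) a2) (digit (P ^ N) a3).
Proof.
move=> P2 N1; have Q2 := expn_ge2 P2 N1; have P0 := ltnW P2.
have fold_foldM M a : M <= N -> fold (P ^ M) (fold (P ^ N) a) = fold (P ^ M) a.
  by move=> MN; rewrite -(subnK MN) expnD fold_fold ?expn_gt0 ?P0.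
rewrite dagC1 1?(leq_trans P2) ?leq_pmull //; set Q := P ^ N in Q2 *.
have step : triangle_bounded Q (fold Q a1) (fold Q a2) (fold Q a3) ->
    triangle_bounded (P ^ N.+1) a1 a2 a3 =
    triangle_bounded (2 * P) (digit Q a1) (digit Q a2) (digit Q a3).
  move=> T; have [h1 h2 h3] := triangle_bounded_half Q2 T.
  by rewrite expnS -(triangle_bounded_unfold _ _ _ P2 Q2 T) !unfoldK.
apply/dagCP/andP => // -[Ta TM].
  have TQ : triangle_bounded Q (fold Q a1) (fold Q a2) (fold Q a3).
    by apply: TM; rewrite N1 leqnSn.
  rewrite -step //; split=> //; apply/dagCP => //; split=> // M /andP[M1 MN].
  by rewrite !fold_foldM //; apply: TM; rewrite M1 ltnW.
move: Ta => /dagCP[] // TQ TM'; have Ta := TM; rewrite -step // in Ta.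
split=> // M /andP[M1]; rewrite leq_eqVlt => /orP[/eqP->|].
  by rewrite triangle_bounded_fold // expn_ge2.
rewrite ltnS => MN; have := TM' M; rewrite M1 MN !fold_foldM //; exact.
Qed.

(** * Edge-numberings *)

Lemma edge_numberingP P N (G : trivalent_graph) (l : {ffun edge G -> nat}) :
  reflect (forall v h1 h2 h3, h1 \in branches v -> h2 \in branches v ->
     h3 \in branches v -> uniq [:: h1; h2; h3] ->
     dagC P N (l (eps h1)) (l (eps h2)) (l (eps h3)))
  (edge_numbering P N l).
Proof.
apply: (iffP forallP) => H v.
  move=> h1 h2 h3 b1 b2 b3; have /forall_inP/(_ _ b1) := H v.
  by move=> /forall_inP/(_ _ b2) /forall_inP/(_ _ b3) /implyP.
apply/forall_inP => h1 b1; apply/forall_inP => h2 b2; apply/forall_inP => h3 b3.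
by apply/implyP; apply: H b1 b2 b3.
Qed.

(** Every edge carries a half-edge, and its vertex has two further branches, so
    no label escapes the vertex conditions. *)
Lemma edge_numbering_half P N (G : trivalent_graph)
    (l : {ffun edge G -> nat}) e : 2 <= P -> 1 <= N ->
  edge_numbering P N l -> 2 * l e + 1 < P ^ N.
Proof.
move=> P2 N1 /edge_numberingP numl.
have [h /eqP <-] : exists h, eps h == e.
  have : 0 < #|[set h | eps h == e]| by rewrite card_eps_fiber.
  by case/card_gt0P => h; rewrite inE; exists h.
have bh : h \in branches (nu h) by rewrite inE.
have := tgraphP (nu h); rewrite (cardsD1 h) bh add1n => -[] /eqP.
case/cards2P => h2 [h3 [h23 bE]].
have /setD1P[h2h b2] : h2 \in branches (nu h) :\ h by rewrite bE set21.
have /setD1P[h3h b3] : h3 \in branches (nu h) :\ h by rewrite bE set22.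
apply: (dagC_half P2 N1); apply: numl bh b2 b3 _.
by rewrite /= !inE negb_or h23 ![h == _]eq_sym h2h h3h.
Qed.

Definition relabel (G : graph) (F : nat -> nat) (l : {ffun edge G -> nat}) :
    {ffun edge G -> nat} := [ffun e => F (l e)].

Lemma edge_numberingS P N (G : trivalent_graph) (l : {ffun edge G -> nat}) :
  2 <= P -> 1 <= N ->
  edge_numbering P N.+1 l =
  edge_numbering P N (relabel (fold (P ^ N)) l) &&
  edge_numbering (2 * P) 1 (relabel (digit (P ^ N)) l).
Proof.
move=> P2 N1; apply/edge_numberingP/andP.
  move=> numl; split; apply/edge_numberingP => v h1 h2 h3 b1 b2 b3 u;
  by have := numl v h1 h2 h3 b1 b2 b3 u;
    rewrite dagCS // => /andP[]; rewrite !ffunE.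
case=> /edge_numberingP numf /edge_numberingP numd v h1 h2 h3 b1 b2 b3 u.
rewrite dagCS //; have := numd v h1 h2 h3 b1 b2 b3 u; rewrite !ffunE => ->.
by have := numf v h1 h2 h3 b1 b2 b3 u; rewrite !ffunE => ->.
Qed.

(** * Splitting off the top digit of a numbering *)

Section TopDigit.

Variables (P N : nat) (P2 : 2 <= P) (N1 : 1 <= N).

Lemma Ed_fold_subproof G (l : Ed P N.+1 G) :
  edge_numbering P N (relabel (fold (P ^ N)) (val l)).
Proof. by have := valP l; rewrite edge_numberingS // => /andP[]. Qed.

Definition Ed_fold G (l : Ed P N.+1 G) : Ed P N G :=
  exist (@edge_numbering P N G) _ (Ed_fold_subproof l).

Lemma Ed_digit_subproof G (l : Ed P N.+1 G) :
  edge_numbering (2 * P) 1 (relabel (digit (P ^ N)) (val l)).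
Proof. by have := valP l; rewrite edge_numberingS // => /andP[]. Qed.

Definition Ed_digit G (l : Ed P N.+1 G) : Ed (2 * P) 1 G :=
  exist (@edge_numbering (2 * P) 1 G) _ (Ed_digit_subproof l).

Definition unfold_label G (b : Ed P N G) (d : Ed (2 * P) 1 G) :
  {ffun edge G -> nat} := [ffun e => unfold (P ^ N) (val b e) (val d e)].

Lemma fold_unfold_label G (b : Ed P N G) (d : Ed (2 * P) 1 G) :
  relabel (fold (P ^ N)) (unfold_label b d) = val b.
Proof.
apply/ffunP => e; rewrite !ffunE fold_unfold //.
exact: edge_numbering_half (valP b).
Qed.

Lemma digit_unfold_label G (b : Ed P N G) (d : Ed (2 * P) 1 G) :
  relabel (digit (P ^ N)) (unfold_label b d) = val d.
Proof.
apply/ffunP => e; rewrite !ffunE digit_unfold //.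
exact: edge_numbering_half (valP b).
Qed.

Lemma Ed_unfold_subproof G (b : Ed P N G) (d : Ed (2 * P) 1 G) :
  edge_numbering P N.+1 (unfold_label b d).
Proof.
rewrite edge_numberingS // fold_unfold_label digit_unfold_label.
by rewrite (valP b) (valP d).
Qed.

Definition Ed_unfold G (b : Ed P N G) (d : Ed (2 * P) 1 G) : Ed P N.+1 G :=
  exist (@edge_numbering P N.+1 G) _ (Ed_unfold_subproof b d).

Lemma Ed_fold_unfold G (b : Ed P N G) (d : Ed (2 * P) 1 G) :
  Ed_fold (Ed_unfold b d) = b.
Proof. by apply: val_inj; apply: fold_unfold_label. Qed.

Lemma Ed_digit_unfold G (b : Ed P N G) (d : Ed (2 * P) 1 G) :
  Ed_digit (Ed_unfold b d) = d.
Proof. by apply: val_inj; apply: digit_unfold_label. Qed.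

Lemma Ed_unfoldK G (l : Ed P N.+1 G) : Ed_unfold (Ed_fold l) (Ed_digit l) = l.
Proof.
apply: val_inj; apply/ffunP => e; rewrite !ffunE unfoldK //.
by have := edge_numbering_half e P2 N1 (valP (Ed_fold l)); rewrite ffunE.
Qed.

Lemma Ed_fold_pull (G G' : trivalent_graph) (f : local_iso G G')
    (l : Ed P N.+1 G') :
  Ed_fold (Ed_pull f l) = Ed_pull f (Ed_fold l).
Proof. by apply: val_inj; apply/ffunP => e; rewrite !ffunE. Qed.

Lemma Ed_digit_pull (G G' : trivalent_graph) (f : local_iso G G')
    (l : Ed P N.+1 G') :
  Ed_digit (Ed_pull f l) = Ed_pull f (Ed_digit l).
Proof. by apply: val_inj; apply/ffunP => e; rewrite !ffunE. Qed.

End TopDigit.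

(** * The full splitting *)

Definition ffun_rcons n T (x : {ffun 'I_n -> T}) (y : T) :
    {ffun 'I_n.+1 -> T} :=
  [ffun j => oapp x y (unlift ord_max j)].

Lemma ffun_rcons_bij n T :
  bijective (fun z : {ffun 'I_n -> T} * T => ffun_rcons z.1 z.2).
Proof.
exists (fun y : {ffun 'I_n.+1 -> T} =>
  ([ffun j : 'I_n => y (lift ord_max j)], y ord_max)) => [[x y]|x] /=.
  by congr pair; [apply/ffunP => j|]; rewrite !ffunE ?liftK ?unlift_none.
apply/ffunP => j; rewrite ffunE.
by case: unliftP => [k ->|->] //=; rewrite ffunE.
Qed.

Theorem theorem2 (P N : nat) (hP : (3 <= P)%N) (oddP : odd P) (hN : (1 <= N)%N) :
  exists Phi : forall G : trivalent_graph, Ed P N G -> Ed_split P N G,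
    Ed_natural Phi /\ forall G : trivalent_graph, bijective (Phi G).
Proof.
have P2 := ltnW hP; case: N hN => // n _.
elim: n => [|n [Phi [natPhi bijPhi]]].
  have no_digit T (x y : {ffun 'I_0 -> T}) : x = y by apply/ffunP; case.
  exists (fun G l => (l, ffun0 (card_ord 0))); split.
    by move=> G G' f l; congr pair; apply: no_digit.
  move=> G; exists fst => // -[l x]; congr pair; apply: no_digit.
have N1 : 1 <= n.+1 by [].
exists (fun G l => let x := Phi G (Ed_fold P2 N1 l) in
  (x.1, ffun_rcons x.2 (Ed_digit P2 N1 l))); split.
  move=> G G' f l; rewrite /= Ed_fold_pull Ed_digit_pull natPhi.
  congr pair; apply/ffunP => j; rewrite !ffunE.
  by case: unliftP => [k _|_] //=; rewrite ffunE.
move=> G; have [Psi PhiK PsiK] := bijPhi G.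
have [split_last rconsK split_lastK] := ffun_rcons_bij n (Ed (2 * P) 1 G).
exists (fun y =>
  let z := split_last y.2 in Ed_unfold P2 N1 (Psi (y.1, z.1)) z.2).
  move=> l /=; set x := Phi G _.
  rewrite (rconsK (x.2, _)) /= -surjective_pairing PhiK; exact: Ed_unfoldK.
move=> [y1 y2] /=; rewrite Ed_fold_unfold Ed_digit_unfold PsiK /=.
by congr pair; apply: split_lastK.
Qed.
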